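(* Let $p,q\ge 2$ be integers. Let $u\in A^{\mathbb N}$ be $p$-automatic, generated by $(\tau,\theta)$, and let $(X,\sigma)$ be the shift generated by $u$. Suppose that $\theta$ has a coincidence and is primitive and aperiodic. If $p$ and $q$ are multiplicatively independent and $u$ is also $q$-automatic, then $X$ is finite.
   Context: Let $A,B$ be finite alphabets. A length-$\ell$ substitution on $B$ is a map $\theta:B\to B^{\ell}$, extended by concatenation to finite words $B^*$ and to sequences over $B$; a point $v$ is $\theta$-periodic if $\theta^k(v)=v$ for some $k\ge1$. A length-$\ell$ substitution $\theta$ is: - primitive if there is $k$ such that every $b\in B$ appears in $\theta^k(a)$ for each $a\in B$; - aperiodic if the shift $(X_\theta,\sigma)$ contains no shift-periodic points, where $X_\theta\subseteq B^{\mathbb Z}$ is the set of bi-infinite sequences all of whose finite subwords are subwords of $\theta^n(a)$ for some $a\in B$ and $n\in\mathbb N$; - said to have a coincidence if there exist $n\ge0$, $1\le i\le \ell^n$ and a letter $b\in B$ such that the $i$-th letter of $\theta^n(a)$ is $b$ for all $a\in B$. A sequence $u\in A^{\mathbb N}$ is $\ell$-automatic, generated by $(\tau,\theta)$, if $\theta$ is a length-$\ell$ substitution on some finite alphabet $B$, $\tau:B^{\mathbb Z}\to A^{\mathbb Z}$ is a continuous shift-commuting map (given by a local rule), and $u$ is the restriction to $\mathbb N$ of $\tau(v)$ for some $\theta$-periodic point $v\in B^{\mathbb Z}$. Saying that $u$ is $q$-automatic means that it is generated by some pair $(\tau',\theta')$ with $\theta'$ a length-$q$ substitution on some finite alphabet.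 The shift generated by $u\in A^{\mathbb N}$ is $(X,\sigma)$, where $X\subseteq A^{\mathbb Z}$ is the set of bi-infinite sequences all of whose finite subwords occur in $u$, and $\sigma$ is the left shift. Integers $p,q\ge2$ are multiplicatively independent if $p^a\ne q^b$ for all positive integers $a,b$. *)

(* Defs.v *)
From mathcomp Require Import all_boot all_order all_algebra.
From mathcomp Require Import all_classical all_reals topology.

Set Implicit Arguments.
Unset Strict Implicit.
Unset Printing Implicit Defensive.

Import Order.TTheory GRing.Theory Num.Theory.

Local Open Scope classical_set_scope.
Local Open Scope ring_scope.

Section Sequences.
Variable A : Type.
Implicit Types (x : int -> A) (u : nat -> A).

Definition shift x : int -> A := fun i => x (i + 1).

Definition shift_periodic x : Prop :=
  exists2 m : nat, (0 < m)%N & iter m shift x = x.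

Definition subword x (i : int) (n : nat) : seq A :=
  mkseq (fun k => x (i + k%:Z)) n.

Definition subwordN u (i n : nat) : seq A := mkseq (fun k => u (i + k)%N) n.

Definition shift_of u : set (int -> A) :=
  [set x | forall (i : int) (n : nat),
             exists j : nat, subword x i n = subwordN u j n].

End Sequences.

Section Substitutions.
Variables (l : nat) (B : finType).

Definition substitution : Type := B -> l.-tuple B.

Implicit Type theta : substitution.

Definition subst_word theta (w : seq B) : seq B :=
  flatten [seq tval (theta b) | b <- w].

Definition subst_pow theta (n : nat) (a : B) : seq B :=
  iter n (subst_word theta) [:: a].

(* The block theta (v 0) starts at coordinate 0: coordinate l * m + r of
   theta (v), with 0 <= r < l, is the r-th letter of theta (v m).  The default
   value of nth is used only in the degenerate case l = 0. *)
Definition subst_seq theta (v : int -> B) : int -> B :=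
  fun i => nth (v i) (theta (v (i %/ l%:Z)%Z)) `|(i %% l%:Z)%Z|%N.

Definition subst_periodic theta (v : int -> B) : Prop :=
  exists2 k : nat, (0 < k)%N & iter k (subst_seq theta) v = v.

Definition subst_shift theta : set (int -> B) :=
  [set x | forall (i : int) (n : nat),
             exists (a : B) (m : nat), infix (subword x i n)
                                             (subst_pow theta m a)].

Definition subst_primitive theta : Prop :=
  exists k : nat, forall a b : B, b \in subst_pow theta k a.

Definition subst_aperiodic theta : Prop :=
  forall x, subst_shift theta x -> ~ shift_periodic x.

(* Letters of a word are numbered from 0 here, so i stands for i - 1 in the
   usual numbering 1, ..., l ^ n. *)
Definition has_coincidence theta : Prop :=
  exists (n i : nat) (b : B),
    (i < l ^ n)%N /\ forall a : B, onth (subst_pow theta n a) i = Some b.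

End Substitutions.

Section Automatic.
Variables (A B : finType).

(* The full shifts carry the product of the discrete topologies. *)
Definition continuous_shift_commuting (tau : (int -> B) -> (int -> A)) : Prop :=
  continuous (tau : {ptws int -> discrete_topology B} ->
                    {ptws int -> discrete_topology A})
  /\ forall x, tau (shift x) = shift (tau x).

Definition automatic_by (l : nat) (tau : (int -> B) -> (int -> A))
    (theta : substitution l B) (u : nat -> A) : Prop :=
  continuous_shift_commuting tau
  /\ exists v : int -> B,
       subst_periodic theta v /\ forall n : nat, u n = tau v n%:Z.

End Automatic.

Definition automatic (A : finType) (l : nat) (u : nat -> A) : Prop :=
  exists (B : finType) (tau : (int -> B) -> (int -> A))
         (theta : substitution l B), automatic_by tau theta u.

Definition multiplicatively_independent (p q : nat) : Prop :=
  forall a b : nat, (0 < a)%N -> (0 < b)%N -> (p ^ a)%N <> (q ^ b)%N.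

(* Main.v *)
Require Import Defs.
From mathcomp Require Import all_boot all_order all_algebra.
From mathcomp Require Import all_classical all_reals topology.
From mathcomp Require Import zify.

(** The proof is Krebs's short proof of Cobham's theorem: a sequence that is
automatic for two multiplicatively independent bases is eventually periodic,
and the shift generated by an eventually periodic sequence is a single
periodic orbit.

Automaticity enters only through the following self-similarity.  If [v] is
fixed by the [k]-th power of a substitution of length [p], put [P = p ^ k];
for [K] a power of [P], the block of [v] of length [K] at position [K * n] is
determined by the letter [v n].  Since [tau] has a finite radius, once [K]
is at least that radius the block of [u] of length [3 * K] at position [K * n] is
determined by a colour [s n], a window of five letters of [v] around [n]
([automatic_by_blocks]).  The colouring [s] takes finitely many values and does
not depend on [K].  The second base gives in the same way a colouring [t] that
determines the blocks of [u] at the positions [L * n], for [L] a power of [Q].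

By pigeonhole there are powers [K] and [L] that are different but arbitrarily
close relative to their size ([close_powers]).  Suppose [K < L], and let
[m1 < m2] have the same [s]-colour and the same [t]-colour.  Near [K * m1],
which is close to [L * m1], the sequence [u] is unchanged both by the
translation by [K * (m2 - m1)] and by the one by [L * (m2 - m1)], so near
[K * m2] it has the local period [(L - K) * (m2 - m1)], far smaller than [K].
The point is that this local period is then inherited by all blocks at
[K * n] with [s n = s m2].  Only finitely many pairs [(m1, m2)] are needed to
serve all colours that occur far out ([recurrent_colours]), and they can be
fixed before [K] and [L] are chosen.  Hence all blocks far out have a common
local period shorter than their overlaps, and [u] is eventually periodic
([close_blocks_periodic]). *)

Set Implicit Arguments.
Unset Strict Implicit.
Unset Printing Implicit Defensive.

Import Order.TTheory GRing.Theory Num.Theory.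

(** * Continuous shift-commuting maps are given by a local rule *)

Section LocalRule.
Local Open Scope classical_set_scope.
Local Open Scope ring_scope.

Definition agree_upto (B : Type) (R : nat) (x y : int -> B) : Prop :=
  forall j : int, `|j| <= R%:Z -> x j = y j.

(** The filter generated by the cylinders around [x] converges to [x] in each
coordinate, hence in the product topology. *)
Lemma nbhs_agree_upto (B : finType)
    (x : {ptws int -> discrete_topology B}) (U : set (int -> B)) :
  nbhs x U -> exists R : nat, agree_upto R x `<=` U.
Proof.
pose F := filter_from [set: nat] (fun R => agree_upto R x).
have FF : Filter F.
  apply: filter_from_filter; first by exists 0%N.
  move=> R S _ _; exists (maxn R S) => // y xy; split=> j jR; apply: xy; lia.
have : F --> x.
  apply/cvg_sup => i; apply/cvg_image.
    by rewrite eqEsubset; split=> // b _; exists (fun=> b).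
  move=> W /principal_filterP Wx.
  exists ((fun y : int -> B => y i) @^-1` W).
    by exists `|i|%N => // y xy /=; rewrite -xy //; lia.
  by rewrite eqEsubset; split=> [_ [y Wy <-]|b Wb] //; exists (fun=> b).
by move=> Fx /Fx[R _ RU]; exists R.
Qed.

Lemma agree_upto_nbhs (B : finType)
    (x : {ptws int -> discrete_topology B}) (R : nat) :
  nbhs x (agree_upto R x).
Proof.
have nF : Filter (nbhs x) := nbhs_filter x.
have near1 (j : int) : nbhs x [set y : int -> B | x j = y j].
  have := @proj_continuous int (fun=> discrete_topology B) j x.
  move=> /(_ _ (discrete_set1 (x j))) h.
  by apply: (@filterS _ (nbhs x) _ _ _ _ h) => y /= yj; rewrite -[LHS]yj.
elim: R => [|R IH].
  by apply: filterS (near1 0) => y xy j j0; have -> : j = 0 by lia.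
apply: filterS (filterI IH (filterI (near1 R.+1%:Z) (near1 (- R.+1%:Z)))).
move=> y [xy [xy1 xy2]] j jR.
have [->|/eqP n1] := eqVneq j R.+1%:Z; first exact: xy1.
have [->|/eqP n2] := eqVneq j (- R.+1%:Z); first exact: xy2.
by apply: xy; lia.
Qed.

Lemma compact_full_shift (B : finType) :
  compact [set: {ptws int -> discrete_topology B}].
Proof.
have compactB : compact [set: discrete_topology B].
  by apply: finite_compact; apply: (@finite_finset B).
have := @tychonoff int (fun=> discrete_topology B) _ (fun=> compactB).
by congr (compact _); rewrite eqEsubset.
Qed.

(** Continuity gives each [x] a radius of its own that also serves the points
near [x]; compactness of the full shift makes it uniform. *)
Lemma local_rule (A B : finType) (tau : (int -> B) -> (int -> A)) :
  continuous_shift_commuting tau -> exists R : nat,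
    forall x y : int -> B, agree_upto R x y -> tau x 0 = tau y 0.
Proof.
move=> [ctau _].
have /compact_near_coveringP cover := @compact_full_shift B.
have [|R _ RP] := cover nat \oo
  (fun R x => forall y, agree_upto R x y -> tau x 0 = tau y 0) _ _.
  move=> x _.
  have : nbhs x [set y | tau y 0 = tau x 0].
    have := @proj_continuous int (fun=> discrete_topology A) 0 (tau x).
    by move=> /(cvg_comp _ _ (ctau x))
      /(_ _ (discrete_set1 (tau x 0 : discrete_topology A))).
  move=> /nbhs_agree_upto[R0 R0P].
  exists (agree_upto R0 x, [set R | (R0 <= R)%N]).
    by split; [exact: agree_upto_nbhs | exact: nbhs_infty_ge].
  move=> [x' R] /= [xx' leR] y x'y.
  rewrite (R0P _ xx') (R0P y) // => j jR.
  by rewrite xx' //; apply: x'y; lia.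
by exists R => x y; apply: (RP R) => /=.
Qed.

Lemma local_rule_nat (A B : finType) (tau : (int -> B) -> (int -> A)) :
  continuous_shift_commuting tau -> exists R : nat,
    forall (x : int -> B) (m n : nat),
      (forall j : int, `|j| <= R%:Z -> x (m%:Z + j) = x (n%:Z + j)) ->
      tau x m%:Z = tau x n%:Z.
Proof.
move=> tauP; have [R RP] := local_rule tauP; exists R => x m n xmn.
have iter_shift (T : Type) (y : int -> T) (k : nat) (j : int) :
    iter k (@shift T) y j = y (k%:Z + j).
  elim: k j => [|k IH] j; first by rewrite add0r.
  by rewrite iterS {1}/shift IH; congr y; lia.
have tau_iter k : tau x k%:Z = tau (iter k (@shift B) x) 0.
  suff -> : tau (iter k (@shift B) x) = iter k (@shift A) (tau x).
    by rewrite iter_shift addr0.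
  by elim: k => //= k <-; case: tauP.
by rewrite !tau_iter; apply: RP => j jR; rewrite !iter_shift xmn.
Qed.

End LocalRule.

(** * Self-similarity of automatic sequences *)

Section Blocks.
Local Open Scope ring_scope.

Lemma iter_subst_seq_block (l : nat) (B : finType) (theta : substitution l B)
    (v : int -> B) (k r : nat) (m n : int) :
  (r < l ^ k)%N -> v m = v n ->
  iter k (subst_seq theta) v ((l ^ k)%N%:Z * m + r%:Z) =
  iter k (subst_seq theta) v ((l ^ k)%N%:Z * n + r%:Z).
Proof.
move=> + vmn; elim: k r => [|k IH] r ltr.
  have -> : r = 0%N by lia.
  by rewrite expn0 !mul1r !addr0.
have l0 : (0 < l)%N by case: l {theta IH} ltr => //; rewrite exp0n.
have lz : l%:Z != 0 by lia.
(* The default [v 0] replaces one that depends on the coordinate. *)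
have rec (i : int) :
    iter k.+1 (subst_seq theta) v ((l ^ k.+1)%N%:Z * i + r%:Z) =
    nth (v 0) (theta (iter k (subst_seq theta) v
                        ((l ^ k)%N%:Z * i + (r %/ l)%N%:Z))) (r %% l).
  have e : (l ^ k.+1)%N%:Z * i + r%:Z =
      ((l ^ k)%N%:Z * i + (r %/ l)%N%:Z) * l%:Z + (r %% l)%N%:Z.
    by rewrite {1}(divn_eq r l) expnS !PoszM PoszD PoszM; lia.
  rewrite iterS {1}/subst_seq e divzMDl // modzMDl.
  rewrite divz_nat modz_nat absz_nat (divn_small (ltn_pmod r l0)) addr0.
  by rewrite modn_mod; apply: set_nth_default; rewrite size_tuple ltn_pmod.
by rewrite !rec IH // ltn_divLR // mulnC -expnS.
Qed.

(** The factor 3 leaves a margin of [K] on both sides of the middle third of a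
block: a letter there stays in the block when translated by at most [K], and
also lies in a block of slightly different length starting nearby. *)
Definition codes_blocks (A S : Type) (s : nat -> S) (u : nat -> A)
    (K : nat) : Prop :=
  forall m n r : nat, (r < 3 * K)%N -> s m = s n ->
    u (K * m + r)%N = u (K * n + r)%N.

(** If [K] is at least the radius of [tau], the letters of [u] in
[[K * n, K * n + 3 * K)] depend on those of [v] in
[[K * (n - 1), K * (n + 4))], hence on the five letters
[v (n - 1), ..., v (n + 3)], which form the colour of [n]. *)
Lemma automatic_by_blocks (A B : finType) (q : nat) (u : nat -> A)
    (tau : (int -> B) -> (int -> A)) (theta : substitution q B) :
  (0 < q)%N -> automatic_by tau theta u ->
  exists (k : nat) (S : finType) (s : nat -> S) (R : nat), (0 < k)%N /\
    forall a : nat, (R <= (q ^ k) ^ a)%N -> codes_blocks s u ((q ^ k) ^ a).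
Proof.
move=> q0 [tauP [v [[k k0 vk] uv]]].
have [R RP] := local_rule_nat tauP.
pose s (n : nat) := [ffun j : 'I_5 => v (n%:Z + j%:Z - 1)].
exists k, _, s, R; split=> // a leR m n r ltr smn.
rewrite -expnM in leR ltr *; move: ltr leR; set K := (q ^ (k * a))%N => ltr leR.
have K0 : (0 < K)%N by rewrite expn_gt0 q0.
have vfix : iter (k * a) (subst_seq theta) v = v.
  by elim: a {leR ltr K K0} => [|a IH]; rewrite ?muln0 // mulnS iterD IH.
rewrite !uv; apply: RP => i iR.
have Kz : K%:Z != 0 by lia.
(* [j] numbers the block inside the window, starting with block [n - 1]. *)
have e0 := divz_eq (r%:Z + i + K%:Z) K%:Z.
have e1 := modz_ge0 (r%:Z + i + K%:Z) Kz.
have e2 := ltz_pmod (r%:Z + i + K%:Z) (d := K%:Z) K0.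
move: (_ %/ _)%Z (_ %% _)%Z e0 e1 e2 => j c e0 e1 e2.
have j0 : 0 <= j by nia.
have j5 : j < 5 by nia.
have ltj : (`|j| < 5)%N by lia.
have ltc : (`|c| < K)%N by lia.
have split_at (z : nat) :
    (K * z + r)%N%:Z + i = K%:Z * (z%:Z + `|j|%N%:Z - 1) + `|c|%N%:Z.
  by rewrite PoszD PoszM !gez0_abs //; lia.
rewrite !split_at -vfix; apply: iter_subst_seq_block => //.
have := congr1 (fun g : {ffun 'I_5 -> B} => g (Ordinal ltj)) smn.
by rewrite !ffunE.
Qed.

End Blocks.

(** * Close powers, recurrent colours and periods *)

Section Periods.
Local Open Scope nat_scope.

(** Scale [P ^ a] by the largest power [Q ^ b a] below it.  Two exponents
[a1 < a2] for which the integer parts of [N.+1 * P ^ a / Q ^ b a] agree give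
ratios [P ^ a / Q ^ b a] that are close to each other, and the quotient of
these ratios is [P ^ (a2 - a1) / Q ^ (b a2 - b a1)]. *)
Lemma close_powers (P Q N : nat) : 2 <= P -> 2 <= Q ->
  multiplicatively_independent P Q ->
  exists a b : nat, (P ^ a < Q ^ b /\ (Q ^ b - P ^ a) * N <= P ^ a) \/
                    (Q ^ b < P ^ a /\ (P ^ a - Q ^ b) * N <= Q ^ b).
Proof.
move=> hP hQ indep.
pose b a := trunc_log Q (P ^ a).
have bP a : Q ^ b a <= P ^ a < Q ^ (b a).+1.
  by apply: trunc_log_bounds => //; rewrite expn_gt0; lia.
pose f a := (N.+1 * P ^ a) %/ Q ^ b a.
have Qb0 a : 0 < Q ^ b a by rewrite expn_gt0; lia.
have fP a : f a * Q ^ b a <= N.+1 * P ^ a < (f a).+1 * Q ^ b a.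
  by rewrite leq_trunc_div ltn_ceil.
have f_ge a : N < f a.
  by rewrite /f leq_divRL // leq_mul2l; case/andP: (bP a) => ->; rewrite orbT.
have f_lt a : f a < N.+1 * Q.
  rewrite /f ltn_divLR // -mulnA -expnS ltn_mul2l.
  by case/andP: (bP a) => _ ->.
pose g (a : 'I_(N.+1 * Q).+1) : 'I_(N.+1 * Q) := Ordinal (f_lt a).
have [a1 [a2 [lt12 eqf]]] : exists a1 a2 : nat, a1 < a2 /\ f a1 = f a2.
  have /injectivePn[x [y neq eqg]] : ~~ injectiveb g.
    by apply/negP => /injectiveP/leq_card; rewrite !card_ord ltnn.
  have eqf : f x = f y by case: eqg.
  case: (ltngtP x y) => xy; [by exists x, y | by exists y, x |].
  by case/eqP: neq; apply: val_inj.
have leb : b a1 <= b a2 by apply: leq_trunc_log; rewrite leq_exp2l //; lia.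
exists (a2 - a1), (b a2 - b a1).
have eK : P ^ a2 = P ^ (a2 - a1) * P ^ a1 by rewrite -expnD subnK // ltnW.
have eL : Q ^ b a2 = Q ^ (b a2 - b a1) * Q ^ b a1 by rewrite -expnD subnK.
have KL : P ^ (a2 - a1) <> Q ^ (b a2 - b a1).
  case: (posnP (b a2 - b a1)) => [->|b0]; last by apply: indep; lia.
  have : 1 < P ^ (a2 - a1) by rewrite -(exp1n (a2-a1)) ltn_exp2r; lia.
  by rewrite expn0; lia.
have := fP a1; have := fP a2; rewrite -eqf eK eL.
have := f_ge a1; have := Qb0 a1; have : 0 < P ^ a1 by rewrite expn_gt0; lia.
have : 0 < P ^ (a2 - a1) by rewrite expn_gt0; lia.
move: (f a1) (P ^ a1) (Q ^ b a1) KL.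
move: (P ^ _) (Q ^ _) => K L F x y KL K0 x0 y0 NF /andP[h1 h2] /andP[h3 h4].
(* Both [x / y] and [K * x / (L * y)] lie in [[F, F.+1) / N.+1], so [K / L]
   lies strictly between [F / F.+1] and [F.+1 / F]. *)
have KF : K * F < L * F.+1.
  have : K * F * (x * y) < L * F.+1 * (x * y); last by rewrite ltn_pmul2r //; lia.
  have A : x * K * (F * y) <= x * K * (N.+1 * x) by rewrite leq_mul2l h3 orbT.
  have B : x * (N.+1 * (K * x)) < x * (F.+1 * (L * y)) by rewrite ltn_pmul2l.
  by move: A B; lia.
have LF : L * F < K * F.+1.
  have : L * F * (x * y) < K * F.+1 * (x * y); last by rewrite ltn_pmul2r //; lia.
  have A : x * (F * (L * y)) <= x * (N.+1 * (K * x)) by rewrite leq_mul2l h1 orbT.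
  have B : x * K * (N.+1 * x) < x * K * (F.+1 * y) by rewrite ltn_pmul2l //; lia.
  by move: A B; lia.
have diff x' y' : x' * F < y' * F.+1 -> y' < x' -> (x' - y') * N <= y'.
  move=> h lt; apply: leq_trans (_ : (x' - y') * F <= _).
    by rewrite leq_mul2l ltnW ?orbT.
  by rewrite mulnBl leq_subLR addnC -mulnS ltnW.
by case: (ltngtP K L) => // lt; [left|right]; split => //; apply: diff.
Qed.

Lemma recurrent_colours (C : finType) (c : nat -> C) :
  exists N M : nat, forall n, N <= n ->
    exists m1 m2 : nat, [/\ m1 < m2, m2 <= M, c m1 = c n & c m2 = c n].
Proof.
have bounds x : exists NM : nat * nat, forall n, NM.1 <= n -> c n = x ->
    exists m1 m2 : nat, [/\ m1 < m2, m2 <= NM.2, c m1 = x & c m2 = x].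
  have [[m1 [m2 [lt12 cm1 cm2]]]|once] :=
    pselect (exists m1 m2 : nat, [/\ m1 < m2, c m1 = x & c m2 = x]).
    by exists (0, m2) => n _ _; exists m1, m2.
  (* A colour that occurs at most once is excluded by the choice of [N]. *)
  have [[n0 cn0]|never] := pselect (exists n, c n = x); last first.
    by exists (0, 0) => n _ cn; case: never; exists n.
  by exists (n0.+1, 0) => n lt cn; case: once; exists n0, n.
have [NM NMP] := fin_all_exists bounds.
exists (\max_x (NM x).1), (\max_x (NM x).2) => n leNn.
have le1 : (NM (c n)).1 <= n.
  by apply: leq_trans leNn; apply: (leq_bigmax (F := fun x => (NM x).1)).
have [m1 [m2 [lt12 le2 c1 c2]]] := NMP (c n) n le1 erefl.
exists m1, m2; split=> //; apply: leq_trans le2 _.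
exact: (leq_bigmax (F := fun x => (NM x).2)).
Qed.

(** The local period [(L - K) * (m2 - m1)] of the block at [K * n] comes from
moving its letters, by the [s]-colour, to the block at [K * m1], then by the
[t]-colour forward by [L * (m2 - m1)], and back by the [s]-colour; the last
move undoes only [K * (m2 - m1)] of the previous one.  All these periods divide
[(L - K) * M`!], which is therefore common to all blocks. *)
Lemma close_blocks_periodic (A S T : Type) (u : nat -> A) (s : nat -> S)
    (t : nat -> T) (K L N M : nat) :
  codes_blocks s u K -> codes_blocks t u L ->
  (forall n, N <= n -> exists m1 m2 : nat,
     [/\ m1 < m2, m2 <= M, s m1 = s n, s m2 = s n & t m1 = t m2]) ->
  K < L -> (L - K) * M`! <= K ->
  forall i, K * N.+1 <= i -> u (i + (L - K) * M`!) = u i.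
Proof.
move=> us ut rec ltKL small.
have leM : M <= M`!.
  by case: M {rec small} => // M; rewrite factS leq_pmulr ?fact_gt0.
have step n : N <= n -> exists2 d, 0 < d <= M &
    forall r, K <= r -> r + (L - K) * d < 3 * K ->
      u (K * n + (r + (L - K) * d)) = u (K * n + r).
  move=> /rec[m1 [m2 [lt12 le2 s1 s2 t12]]]; exists (m2 - m1); first by lia.
  move=> r ler ltr.
  have le_em : (L - K) * m1 <= r by nia.
  rewrite -(us m2 n (r + _)) // -(us m1 n r) //; last by nia.
  have e1 : K * m1 + r = L * m1 + (r - (L - K) * m1) by nia.
  rewrite e1 (ut m1 m2) //; last by nia.
  by congr u; nia.
have steps n r : N <= n -> K <= r < 2 * K ->
    u (K * n + (r + (L - K) * M`!)) = u (K * n + r).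
  move=> /step[d /andP[d0 dM] ud] /andP[ler ltr].
  have /dvdnP[c def] : d %| M`! by rewrite dvdn_fact // d0.
  have : forall j, j <= c -> u (K * n + (r + (L - K) * (j * d))) = u (K * n + r).
    elim=> [|j IH] lej; first by rewrite mul0n muln0 addn0.
    have jc : (L - K) * (j.+1 * d) <= (L - K) * M`!.
      by rewrite leq_mul2l def leq_mul2r lej !orbT.
    have e : r + (L - K) * (j.+1 * d) = r + (L - K) * (j * d) + (L - K) * d by lia.
    by rewrite e ud ?IH //; lia.
  by move/(_ c (leqnn c)); rewrite -def.
move=> i lei.
have K0 : 0 < K by have := fact_gt0 M; nia.
have ei := divn_eq i K; have lti := ltn_pmod i K0.
have leN : N.+1 <= i %/ K by rewrite leq_divRL // mulnC.
(* Read [i] in the middle third of the block before its own. *)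
have ei' : i = K * (i %/ K).-1 + (K + i %% K).
  have : i %/ K = (i %/ K).-1.+1 by lia.
  by move: (i %/ K).-1 => z ez; move: ei; rewrite ez; lia.
by rewrite ei' -addnA steps //; lia.
Qed.

End Periods.

(** * Shifts generated by eventually periodic sequences *)

Section FiniteShift.
Local Open Scope classical_set_scope.
Local Open Scope ring_scope.

(** A window of [x] ending at [i + d] and reaching back to [i - i0] occurs
somewhere in [u], which puts [i] beyond the preperiod; so the period holds on
all of [x], and [x] is determined by [d] letters. *)
Lemma shift_of_eventually_periodic (A : finType) (u : nat -> A) (i0 d : nat) :
  (0 < d)%N -> (forall i, (i0 <= i)%N -> u (i + d)%N = u i) ->
  finite_set (shift_of u).
Proof.
move=> d0 per.
have perx x : shift_of u x -> forall i : int, x (i + d%:Z) = x i.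
  move=> xX i; have [j ej] := xX (i - i0%:Z) (i0 + d).+1%N.
  have nthj k : (k < (i0 + d).+1)%N -> x (i - i0%:Z + k%:Z) = u (j + k)%N.
    move=> ltk; have := congr1 (fun w => nth (u 0) w k) ej.
    by rewrite !nth_mkseq.
  have := per (j + i0)%N (leq_addl _ _).
  rewrite -addnA -!nthj ?ltnS ?leq_addr //.
  by rewrite PoszD addrA subrK.
have perxm x : shift_of u x ->
    forall (k : nat) (i : int), x (i + (k * d)%N%:Z) = x i.
  move=> xX; elim=> [|k IH] i; first by rewrite mul0n addr0.
  by rewrite mulSn addnC PoszD addrA perx.
pose per_ext (w : {ffun 'I_d -> A}) (i : int) : A :=
  w (Ordinal (ltn_pmod `|(i %% d%:Z)%Z|%N d0)).
apply: (@sub_finite_set _ _ (range per_ext)); last exact: finite_image.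
move=> x xX; exists [ffun j : 'I_d => x j%:Z] => //.
apply/funext => i; rewrite /per_ext ffunE /=.
have dn0 : d%:Z != 0 by lia.
have e1 := modz_ge0 i dn0; have e2 := ltz_pmod i (d := d%:Z) d0.
rewrite modn_small; last by lia.
rewrite gez0_abs //.
have ei := divz_eq i d%:Z.
case: (intP (i %/ d%:Z)%Z) ei => [|k|k] ei.
- by congr x; lia.
- by rewrite -(perxm x xX k.+1); congr x; lia.
- by rewrite -(perxm x xX k.+1 i); congr x; lia.
Qed.

End FiniteShift.

Unset Implicit Arguments.

(** * Automaticity in two independent bases *)

Theorem corollary3p11 (A B : finType) (p q : nat) (hp : (2 <= p)%N)
    (hq : (2 <= q)%N) (u : nat -> A) (tau : (int -> B) -> (int -> A))
    (theta : substitution p B)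
    (hu : automatic_by tau theta u)
    (hcoin : has_coincidence theta)
    (hprim : subst_primitive theta)
    (haper : subst_aperiodic theta)
    (hpq : multiplicatively_independent p q)
    (huq : automatic q u) :
  finite_set (shift_of u).
Proof.
have [k [S [s [R [k0 us]]]]] := automatic_by_blocks (ltnW hp) hu.
have [B' [tau' [theta' hu']]] := huq.
have [k' [T [t [R' [k'0 ut]]]]] := automatic_by_blocks (ltnW hq) hu'.
have [N [M rec]] := recurrent_colours (fun n => (s n, t n)).
have pow_ge2 (x e : nat) : (2 <= x)%N -> (0 < e)%N -> (2 <= x ^ e)%N.
  by move=> x2 e0; rewrite -(exp1n e) ltn_exp2r.
have indep : multiplicatively_independent (p ^ k) (q ^ k').
  by move=> a b a0 b0; rewrite -!expnM; apply: hpq; rewrite muln_gt0 ?k0 ?k'0.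
(* The bound [M`!] makes the period short, [R] and [R'] make the powers
   exceed the radii of the two local rules. *)
have [a [b]] := @close_powers _ _ (M`! + R + R')%N
  (pow_ge2 p k hp k0) (pow_ge2 q k' hq k'0) indep.
have M0 := fact_gt0 M.
have bounds (K L : nat) : (K < L)%N -> ((L - K) * (M`! + R + R') <= K)%N ->
    [/\ (R <= K)%N, (R' <= K)%N, ((L - K) * M`! <= K)%N &
        (0 < (L - K) * M`!)%N].
  by split; nia.
case=> -[lt /(bounds _ _ lt)[leR leR' small d0]];
  apply: (shift_of_eventually_periodic d0).
- apply: (close_blocks_periodic (us _ leR) (ut _ _) _ lt small).
    exact: leq_trans (ltnW lt).
  move=> n /rec[m1 [m2 [lt12 le2 [s1 t1] [s2 t2]]]].
  by exists m1, m2; rewrite t1 t2.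
- apply: (close_blocks_periodic (ut _ leR') (us _ _) _ lt small).
    exact: leq_trans (ltnW lt).
  move=> n /rec[m1 [m2 [lt12 le2 [s1 t1] [s2 t2]]]].
  by exists m1, m2; rewrite s1 s2.
Qed.
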